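(* Let $f:\mathbb{R}^d\to\mathbb{R}$ satisfy the Standing Assumptions with constants $0<\mu\le L$ and $M>0$, and let $\{x_t\},\{G_t\},\{J_t\}$ be generated by General Sharpened-BFGS from an initial point $x_0$ with $$\lambda_0\le\frac{C_0\mu}{ML},\qquad C_0=\frac14\ln\frac32,$$ assuming $\nabla f(x_t)\ne0$ for all $t$ considered. Then for all $t\ge0$, $$\theta(J_t,G_t,x_{t+1}-x_t)\le1-\frac{2\mu}{3L}\qquad\text{and}\qquad \lambda_t\le\left(1-\frac{\mu}{2L}\right)^t\lambda_0,$$ where $\lambda_t:=\lambda_f(x_t)$.
   Context: Standing Assumptions: $f$ is twice differentiable, $\mu$-strongly convex and has $L$-Lipschitz gradient, and is strongly self-concordant with constant $M>0$: for all $x,y,z,w\in\mathbb{R}^d$, $\nabla^2f(y)-\nabla^2f(x)\preceq M\|y-x\|_z\nabla^2f(w)$, where $\|h\|_z:=\sqrt{h^\top\nabla^2f(z)h}$. Newton decrement: $\lambda_f(x):=\sqrt{\nabla f(x)^\top\nabla^2f(x)^{-1}\nabla f(x)}$. $\theta(A,G,u):=\left(\frac{u^\top (G-A)A^{-1}(G-A)u}{u^\top GA^{-1}Gu}\right)^{1/2}$. For symmetric positive definite $A,G$ and $u\ne0$, $\mathrm{BFGS}(A,G,u):=G-\frac{Guu^\top G}{u^\top Gu}+\frac{Auu^\top A}{u^\top Au}$, and $\bar u(A,G):=\arg\max_{u\in\{e_1,\dots,e_d\}}\frac{u^\top Gu}{u^\top Au}$ (ties broken arbitrarily). General Sharpened-BFGS: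 set $G_0=LI$; for $t=0,1,2,\dots$: $x_{t+1}=x_t-G_t^{-1}\nabla f(x_t)$; $s_t=x_{t+1}-x_t$; $J_t=\int_0^1\nabla^2f(x_t+\tau s_t)\,d\tau$; $\bar G_t=\mathrm{BFGS}(J_t,G_t,s_t)$; $r_t=\|s_t\|_{x_t}$; $\hat G_t=(1+Mr_t/2)^2\bar G_t$; $\bar u=\bar u(\nabla^2f(x_{t+1}),\hat G_t)$; $G_{t+1}=\mathrm{BFGS}(\nabla^2f(x_{t+1}),\hat G_t,\bar u)$. *)

(* Defs.v *)
From HB Require Import structures.
From mathcomp Require Import all_boot all_order all_algebra.
From mathcomp Require Import all_classical all_reals all_analysis.
Set Implicit Arguments. Unset Strict Implicit. Unset Printing Implicit Defensive.
Import Order.TTheory GRing.Theory Num.Theory.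
Import numFieldNormedType.Exports.
Local Open Scope classical_set_scope.
Local Open Scope ring_scope.

Section Defs.
Variables (R : realType) (d : nat).
Implicit Types (u v x y : 'cV[R]_d) (A B G : 'M[R]_d).

Definition dotv u v : R := (u^T *m v) 0 0.
Definition enorm v : R := Num.sqrt (dotv v v).
Definition qf A u : R := (u^T *m A *m u) 0 0.
Definition loewner_le A B : Prop := forall u, qf A u <= qf B u.
(* ||h||_z := sqrt(h^T H(z) h), given the Hessian matrix Hz = \nabla^2 f(z) *)
Definition lnorm (Hz : 'M[R]_d) h : R := Num.sqrt (qf Hz h).

Definition theta A G u : R :=
  Num.sqrt (qf ((G - A) *m invmx A *m (G - A)) u / qf (G *m invmx A *m G) u).

Definition BFGS A G u : 'M[R]_d :=
  G - (qf G u)^-1 *: (G *m u *m (u^T *m G)) + (qf A u)^-1 *: (A *m u *m (u^T *m A)).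

Definition ebasis (i : 'I_d) : 'cV[R]_d := delta_mx i 0.

Definition is_ubar A G (i : 'I_d) : Prop :=
  forall j : 'I_d, qf G (ebasis j) / qf A (ebasis j) <= qf G (ebasis i) / qf A (ebasis i).

Definition newton_dec (gx : 'cV[R]_d) (Hx : 'M[R]_d) : R := Num.sqrt (qf (invmx Hx) gx).

Definition Jmat (hess : 'cV[R]_d -> 'M[R]_d) x s : 'M[R]_d :=
  \matrix_(i, j) Rintegral (@lebesgue_measure R) `[0, 1]%classic
                   (fun tau : R => hess (x + tau *: s) i j).

Definition strongly_convex (mu : R) (f : 'cV[R]_d -> R) : Prop :=
  forall x y (a : R), 0 <= a <= 1 ->
    f (a *: x + (1 - a) *: y) <=
      a * f x + (1 - a) * f y - mu / 2 * a * (1 - a) * enorm (x - y) ^+ 2.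

Definition lipschitz_grad (L : R) (grad : 'cV[R]_d -> 'cV[R]_d) : Prop :=
  forall x y, enorm (grad x - grad y) <= L * enorm (x - y).

Definition is_grad_hess (f : 'cV[R]_d -> R) (grad : 'cV[R]_d -> 'cV[R]_d)
    (hess : 'cV[R]_d -> 'M[R]_d) : Prop :=
  forall x, [/\ differentiable f x, differentiable grad x,
     (forall v, 'D_v f x = dotv (grad x) v) &
     (forall v, 'D_v grad x = hess x *m v)].

Definition strongly_self_concordant (M : R) (hess : 'cV[R]_d -> 'M[R]_d) : Prop :=
  forall x y z w, loewner_le (hess y - hess x) ((M * lnorm (hess z) (y - x)) *: hess w).

End Defs.

(* Main.v *)
Require Import Defs.
From HB Require Import structures.
From mathcomp Require Import all_boot all_order all_algebra.
From mathcomp Require Import all_classical all_reals all_analysis.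
From mathcomp Require Import ring lra.
Import Order.TTheory GRing.Theory Num.Theory.
Import numFieldNormedType.Exports.
Local Open Scope ring_scope.

(* Write q = mu / L, l = ln (3/2), rho = 1 - q/2, k_t = 1 + M r_t / 2, and H_t for
   the Hessian at x_t.  Averaging self-concordance along the step shows that J_t
   agrees with both H_t and H_(t+1) up to the factor k_t, and a BFGS update
   preserves two-sided bounds between its two matrices.  Hence
   H_t <= G_t <= (E_t / q) H_t propagates with E_(t+1) = k_t^4 E_t, and the
   correction by k_t^2 in the algorithm restores the lower bound exactly.
   As long as lambda_t <= rho^t lambda_0 one has r_t <= lambda_t, so the products
   of the k_t^4 telescope below exp (l (1 - rho^t)) <= 3/2.  This gives
   J_t <= k_t G_t and G_t <= (3 / (2 q)) J_t, hence theta <= 1 - 2q/3, and the secant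
   equation J_t s_t = grad x_(t+1) - grad x_t turns this into
   lambda_(t+1) <= k_t theta lambda_t <= rho lambda_t. *)

(** * Quadratic forms, positive definite matrices and BFGS updates *)

Section QuadraticForms.
Context {R : realType} {d : nat}.
Implicit Types (u v w p q : 'cV[R]_d) (A B G P S : 'M[R]_d) (a b c k : R).

Lemma dotvE u v : dotv u v = \sum_i u i 0 * v i 0.
Proof. by rewrite /dotv mxE; apply: eq_bigr => i _; rewrite mxE. Qed.

Lemma dotvC u v : dotv u v = dotv v u.
Proof. by rewrite !dotvE; apply: eq_bigr => i _; rewrite mulrC. Qed.

Lemma dotvDr u v w : dotv u (v + w) = dotv u v + dotv u w.
Proof. by rewrite /dotv mulmxDr mxE. Qed.

Lemma dotvZr a u v : dotv u (a *: v) = a * dotv u v.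
Proof. by rewrite /dotv -scalemxAr mxE. Qed.

Lemma dotvNr u v : dotv u (- v) = - dotv u v.
Proof. by rewrite -scaleN1r dotvZr mulN1r. Qed.

Lemma dotvBr u v w : dotv u (v - w) = dotv u v - dotv u w.
Proof. by rewrite dotvDr dotvNr. Qed.

Lemma dotv0r u : dotv u 0 = 0.
Proof. by rewrite -(scale0r u) dotvZr mul0r. Qed.

Lemma dotvDl u v w : dotv (v + w) u = dotv v u + dotv w u.
Proof. by rewrite !(dotvC _ u) dotvDr. Qed.

Lemma dotvZl a u v : dotv (a *: v) u = a * dotv v u.
Proof. by rewrite !(dotvC _ u) dotvZr. Qed.

Lemma dotvNl u v : dotv (- v) u = - dotv v u.
Proof. by rewrite !(dotvC _ u) dotvNr. Qed.

Lemma dotvBl u v w : dotv (v - w) u = dotv v u - dotv w u.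
Proof. by rewrite !(dotvC _ u) dotvBr. Qed.

Definition dotv_linear := (dotvDl, dotvBl, dotvNl, dotvZl, dotvDr, dotvBr, dotvNr, dotvZr).

Lemma dotv_delta i u : dotv (delta_mx i 0) u = u i 0.
Proof.
rewrite dotvE (bigD1 i)//= mxE !eqxx mul1r big1 ?addr0// => j ji.
by rewrite mxE (negbTE ji) mul0r.
Qed.

Lemma dotv_ge0 u : 0 <= dotv u u.
Proof. by rewrite dotvE sumr_ge0// => i _; rewrite -expr2 sqr_ge0. Qed.

Lemma dotv_eq0 u : dotv u u = 0 -> u = 0.
Proof.
rewrite dotvE => /eqP; rewrite psumr_eq0; last by move=> i _; rewrite -expr2 sqr_ge0.
move=> /allP h; apply/matrixP => i j; rewrite ord1 mxE.
have := h i; rewrite mem_index_enum => /(_ isT) /=.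
by rewrite mulf_eq0 orbb => /eqP.
Qed.

Lemma dotv_gt0 u : u != 0 -> 0 < dotv u u.
Proof.
move=> u0; rewrite lt_def dotv_ge0 andbT.
by apply: contra u0 => /eqP /dotv_eq0 ->.
Qed.

Lemma enorm_sqr u : enorm u ^+ 2 = dotv u u.
Proof. by rewrite sqr_sqrtr// dotv_ge0. Qed.

Lemma enorm_ge0 u : 0 <= enorm u. Proof. exact: sqrtr_ge0. Qed.

Lemma dotv_le_enorm u v : dotv u v <= enorm u * enorm v.
Proof.
have [->|v0] := eqVneq v 0; first by rewrite dotv0r mulr_ge0 ?enorm_ge0.
have vv := dotv_gt0 _ v0.
apply: le_trans (ler_norm _) _.
rewrite -(@ler_pXn2r _ 2) ?nnegrE ?mulr_ge0 ?enorm_ge0 ?normr_ge0//.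
rewrite exprMn !enorm_sqr real_normK ?num_real//.
(* This squared norm is [dotv v v] times the Gram determinant of [u] and [v]. *)
have := dotv_ge0 (dotv v v *: u - dotv u v *: v).
rewrite !dotv_linear (dotvC v u).
set x := dotv u u; set y := dotv v v in vv *; set z := dotv u v.
move=> h; have : 0 <= y * (x * y - z ^+ 2) by lra.
by rewrite pmulr_rge0// subr_ge0.
Qed.

Lemma qfE A u : qf A u = dotv u (A *m u).
Proof. by rewrite /qf /dotv mulmxA. Qed.

Lemma dotv_mulmxr A u v : dotv u (A *m v) = dotv (A^T *m u) v.
Proof. by rewrite /dotv trmx_mul trmxK mulmxA. Qed.

Lemma dotv_sym A u v : A^T = A -> dotv u (A *m v) = dotv v (A *m u).
Proof. by move=> As; rewrite dotv_mulmxr As dotvC. Qed.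

Lemma qfD A B u : qf (A + B) u = qf A u + qf B u.
Proof. by rewrite !qfE mulmxDl dotvDr. Qed.

Lemma qfN A u : qf (- A) u = - qf A u.
Proof. by rewrite !qfE mulNmx dotvNr. Qed.

Lemma qfB A B u : qf (A - B) u = qf A u - qf B u.
Proof. by rewrite qfD qfN. Qed.

Lemma qfZ a A u : qf (a *: A) u = a * qf A u.
Proof. by rewrite !qfE -scalemxAl dotvZr. Qed.

Lemma qf_scale a A u : qf A (a *: u) = a ^+ 2 * qf A u.
Proof. by rewrite !qfE -scalemxAr dotvZl dotvZr mulrA. Qed.

Lemma qfNr A u : qf A (- u) = qf A u.
Proof. by rewrite !qfE mulmxN dotvNl dotvNr opprK. Qed.

Lemma qf_mulmx A B u : A^T = A -> qf (A *m B *m A) u = qf B (A *m u).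
Proof. by move=> As; rewrite !qfE -!mulmxA dotv_mulmxr As. Qed.

Lemma qf_sym_expand A a u v : A^T = A ->
  qf A (v - a *: u) = qf A v - 2 * a * dotv u (A *m v) + a ^+ 2 * qf A u.
Proof.
move=> As; rewrite !qfE !(mulmxBr, =^~scalemxAr) !dotv_linear (dotv_sym _ v u As); ring.
Qed.

Definition posdef A : Prop := A^T = A /\ forall u, u != 0 -> 0 < qf A u.

Lemma posdef_sym {A} : posdef A -> A^T = A. Proof. by case. Qed.

Lemma posdef_ge0 A u : posdef A -> 0 <= qf A u.
Proof.
move=> [_ h]; have [->|/h/ltW//] := eqVneq u 0.
by rewrite qfE mulmx0 dotv0r.
Qed.

Lemma posdefZ a A : 0 < a -> posdef A -> posdef (a *: A).
Proof.
move=> a0 [As Ap]; split; first by rewrite linearZ /= As.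
by move=> u /Ap h; rewrite qfZ mulr_gt0.
Qed.

(** A nonzero row vector in the left kernel would have zero quadratic form, against positivity. *)
Lemma posdef_unit A : posdef A -> A \in unitmx.
Proof.
move=> [As Ap]; rewrite -row_free_unit; apply/row_freeP.
exists (invmx A); case: (boolP (A \in unitmx)) => [/mulmxV //|].
rewrite -row_free_unit -kermx_eq0 => /rowV0Pn [r /sub_kermxP rA r0].
have : r^T != 0 by apply: contra r0 => /eqP h; rewrite -(trmxK r) h trmx0.
by move=> /Ap; rewrite /qf trmxK rA mul0mx mxE ltxx.
Qed.

Lemma posdef_mulmx_neq0 A u : posdef A -> u != 0 -> A *m u != 0.
Proof.
move=> [_ Ap] /Ap; apply: contraL => /eqP h.
by rewrite qfE h dotv0r ltxx.
Qed.

Lemma posdef_mulKmx A u : posdef A -> invmx A *m (A *m u) = u.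
Proof. by move=> /posdef_unit Au; rewrite mulKmx. Qed.

Lemma posdef_mulKVmx A u : posdef A -> A *m (invmx A *m u) = u.
Proof. by move=> /posdef_unit Au; rewrite mulKVmx. Qed.

Lemma qf_inv A u : posdef A -> qf (invmx A) u = qf A (invmx A *m u).
Proof. by move=> Ap; rewrite !qfE posdef_mulKVmx// dotvC. Qed.

Lemma posdef_inv A : posdef A -> posdef (invmx A).
Proof.
move=> Ap; split; first by rewrite trmx_inv posdef_sym.
move=> u u0; rewrite qf_inv//; apply: Ap.2.
by apply: contra u0 => /eqP h; rewrite -(posdef_mulKVmx A u Ap) h mulmx0.
Qed.

(* The Fenchel inequality behind order reversal of inversion:
   [qf (invmx A) x] is the maximum over y of [2 <x, y> - qf A y]. *)
Lemma qf_inv_fenchel A x y : posdef A -> 2 * dotv x y - qf A y <= qf (invmx A) x.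
Proof.
move=> Ap.
have := posdef_ge0 _ (invmx A *m x - 1 *: y) Ap.
rewrite qf_sym_expand ?posdef_sym// posdef_mulKVmx// -qf_inv// (dotvC y); lra.
Qed.

(** The Fenchel inequality for [A] is tested at [c^-1 B^-1 x], the maximizer of
    [2 <x, y> - c qf B y]. *)
Lemma qf_inv_le c A B : 0 < c -> posdef A -> posdef B ->
  (forall u, qf A u <= c * qf B u) -> forall x, qf (invmx B) x <= c * qf (invmx A) x.
Proof.
move=> c0 Ap Bp AB x.
have := qf_inv_fenchel A x (c^-1 *: (invmx B *m x)) Ap.
have := AB (c^-1 *: (invmx B *m x)).
rewrite !qf_scale -qf_inv// dotvZr -qfE.
set X := qf (invmx B) x; set Y := qf (invmx A) x => h1 h2.
rewrite -[leLHS]mulr1 -ler_pdivrMl// mulrA.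
have -> : c^-1 * X * 1 = 2 * (c^-1 * X) - c * (c^-1 ^+ 2 * X) by field; rewrite gt_eqF.
by apply: le_trans h2; rewrite lerD2l lerN2.
Qed.

(* Polarization bounds the bilinear form of S by that of P; testing it at
   y = P^-1 S x / b makes the quantity to be bounded appear on both sides. *)
Lemma qf_sandwich_sqr b P S : 0 < b -> posdef P -> S^T = S ->
  (forall u, - (b * qf P u) <= qf S u <= b * qf P u) ->
  forall x, qf (S *m invmx P *m S) x <= b ^+ 2 * qf P x.
Proof.
move=> b0 Pp Ss SP x; rewrite qf_mulmx//.
set y := b^-1 *: (invmx P *m (S *m x)).
have Py : qf P y = b^-1 ^+ 2 * qf (invmx P) (S *m x) by rewrite /y qf_scale -qf_inv.
have Sy : dotv y (S *m x) = b^-1 * qf (invmx P) (S *m x).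
  by rewrite /y dotvZl qfE dotvC.
have /andP[_ h1] := SP (x - (-1) *: y).
have /andP[h2 _] := SP (x - 1 *: y).
move: h1 h2; rewrite !qf_sym_expand ?(posdef_sym Pp)// Py Sy.
set X := qf (invmx P) _; set Z := dotv _ _ => h1 h2.
have h3 : 4 * (b^-1 * X) <= 2 * b * (qf P x + b^-1 ^+ 2 * X) by nra.
have -> : X = b * (4 * (b^-1 * X) - 2 * b * (b^-1 ^+ 2 * X)) / 2.
  by field; rewrite gt_eqF.
rewrite expr2; nra.
Qed.

Lemma qf_rank1 p q v : qf (p *m q^T) v = dotv v p * dotv q v.
Proof. by rewrite /qf mulmxA -mulmxA mxE big_ord1. Qed.

Lemma qf_BFGS A G u v : A^T = A -> G^T = G ->
  qf (BFGS A G u) v = qf G v - (dotv u (G *m v)) ^+ 2 / qf G u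
                     + (dotv u (A *m v)) ^+ 2 / qf A u.
Proof.
move=> As Gs; rewrite /BFGS qfD qfB !qfZ.
have E B : B^T = B -> u^T *m B = (B *m u)^T by move=> Bs; rewrite trmx_mul Bs.
rewrite (E A)// (E G)// !qf_rank1 !(dotvC (_ *m u)) !(dotv_sym _ v u)//.
by rewrite !expr2 !(mulrC _ (_^-1)).
Qed.

Lemma BFGS_sym A G u : A^T = A -> G^T = G -> (BFGS A G u)^T = BFGS A G u.
Proof.
move=> As Gs; rewrite /BFGS linearD linearB !linearZ /=.
by rewrite !trmx_mul trmxK As Gs !mulmxA.
Qed.

Lemma qf_min A u v : A^T = A -> qf A u != 0 ->
  qf A (v - (dotv u (A *m v) / qf A u) *: u)
   = qf A v - (dotv u (A *m v)) ^+ 2 / qf A u.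
Proof. by move=> As Au; rewrite qf_sym_expand//; field. Qed.

Lemma qf_min_le A u v a : posdef A -> u != 0 ->
  qf A v - (dotv u (A *m v)) ^+ 2 / qf A u <= qf A (v - a *: u).
Proof.
move=> Ap u0; have Au := Ap.2 _ u0; rewrite qf_sym_expand ?posdef_sym//.
rewrite -subr_ge0; set b := dotv _ _; set e := qf A u in Au *.
have -> : qf A v - 2 * a * b + a ^+ 2 * e - (qf A v - b ^+ 2 / e)
  = e * (a - b / e) ^+ 2 by field; rewrite gt_eqF.
by rewrite mulr_ge0 ?sqr_ge0 ?ltW.
Qed.

(* [qf G v - <u, G v>^2 / qf G u] is the minimum of [qf G] over the line v + R u,
   so an update only compares such minima for A and G. *)
Lemma BFGS_le k A G u : posdef A -> posdef G -> u != 0 -> 1 <= k ->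
  (forall v, qf G v <= k * qf A v) -> forall v, qf (BFGS A G u) v <= k * qf A v.
Proof.
move=> Ap Gp u0 k1 GA v; rewrite qf_BFGS ?posdef_sym//.
(* The shift is optimal for [A]: it attains the minimum of [qf A] and bounds that of [qf G] from
   above. The nonnegative term [r] added back by the update is absorbed through [1 <= k]. *)
have := qf_min_le G u v (dotv u (A *m v) / qf A u) Gp u0.
have := GA (v - (dotv u (A *m v) / qf A u) *: u).
rewrite qf_min ?posdef_sym// ?gt_eqF ?Ap.2//.
have : 0 <= dotv u (A *m v) ^+ 2 / qf A u by rewrite divr_ge0 ?sqr_ge0 ?posdef_ge0.
set r := _ ^+ 2 / qf A u; set m := _ ^+ 2 / qf G u; nra.
Qed.

(** The argument of [BFGS_le] with roles exchanged: the shift is now optimal for [G]. *)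
Lemma BFGS_ge c A G u : posdef A -> posdef G -> u != 0 -> 1 <= c ->
  (forall v, qf A v <= c * qf G v) -> forall v, qf A v <= c * qf (BFGS A G u) v.
Proof.
move=> Ap Gp u0 c1 AG v; rewrite qf_BFGS ?posdef_sym//.
have := qf_min_le A u v (dotv u (G *m v) / qf G u) Ap u0.
have := AG (v - (dotv u (G *m v) / qf G u) *: u).
rewrite qf_min ?posdef_sym// ?gt_eqF ?Gp.2//.
have : 0 <= dotv u (A *m v) ^+ 2 / qf A u by rewrite divr_ge0 ?sqr_ge0 ?posdef_ge0.
set r := _ ^+ 2 / qf A u; set m := _ ^+ 2 / qf G u; nra.
Qed.

Lemma posdef_dominates c A B : 0 < c -> posdef A -> B^T = B ->
  (forall v, qf A v <= c * qf B v) -> posdef B.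
Proof.
move=> c0 Ap Bs AB; split=> // u u0.
by have := lt_le_trans (Ap.2 _ u0) (AB u); rewrite pmulr_rgt0.
Qed.

Lemma posdef_BFGS c A G u : posdef A -> posdef G -> u != 0 -> 1 <= c ->
  (forall v, qf A v <= c * qf G v) -> posdef (BFGS A G u).
Proof.
move=> Ap Gp u0 c1 AG.
apply: (posdef_dominates c A) => //; first lra.
  by apply: BFGS_sym; exact: posdef_sym.
exact: BFGS_ge.
Qed.

(** Inverting the hypotheses puts [G^-1 - A^-1] between [-(1 - 1/k) A^-1] and [(c - 1) A^-1], and
    [qf_sandwich_sqr] is applied at [G u]. The lower factor stays below 1 however large [k] is. The
    division-free form is the one that [newton_dec_step] takes. *)
Lemma qf_theta_le b c k A G u : posdef A -> posdef G -> 0 < c -> 0 < k -> 0 < b ->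
  c - 1 <= b -> 1 - k^-1 <= b ->
  (forall v, qf A v <= c * qf G v) -> (forall v, qf G v <= k * qf A v) ->
  qf ((G - A) *m invmx A *m (G - A)) u <= b ^+ 2 * qf (G *m invmx A *m G) u.
Proof.
move=> Ap Gp c0 k0 b0 cb kb AG GA.
have Pp := posdef_inv _ Ap.
have Ss : (invmx G - invmx A)^T = invmx G - invmx A.
  by rewrite linearB /= !trmx_inv !posdef_sym.
have sandwich v : - (b * qf (invmx A) v) <= qf (invmx G - invmx A) v <= b * qf (invmx A) v.
  have h0 := posdef_ge0 _ v Pp.
  have h1 := qf_inv_le _ _ _ c0 Ap Gp AG v.
  have := qf_inv_le _ _ _ k0 Gp Ap GA v; rewrite -ler_pdivrMl// => h2.
  by rewrite qfB; apply/andP; split; nra.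
have := qf_sandwich_sqr b _ _ b0 Pp Ss sandwich (G *m u).
have GAs : (G - A)^T = G - A by rewrite linearB /= !posdef_sym.
rewrite (qf_mulmx _ _ _ GAs) (qf_mulmx _ _ _ Ss) (qf_mulmx _ _ _ (posdef_sym Gp)) invmxK.
(* Both sides agree because [A^-1 (G - A) u = (A^-1 - G^-1) G u]. *)
suff -> : qf A ((invmx G - invmx A) *m (G *m u)) = qf (invmx A) ((G - A) *m u) by [].
rewrite mulmxBl posdef_mulKmx// qf_inv// mulmxBl mulmxBr posdef_mulKmx//.
by rewrite -(opprB u) qfNr.
Qed.

Lemma theta_le b c k A G u : posdef A -> posdef G -> u != 0 -> 0 < c -> 0 < k -> 0 < b ->
  c - 1 <= b -> 1 - k^-1 <= b ->
  (forall v, qf A v <= c * qf G v) -> (forall v, qf G v <= k * qf A v) ->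
  theta A G u <= b.
Proof.
move=> Ap Gp u0 c0 k0 b0 cb kb AG GA.
have den0 : 0 < qf (G *m invmx A *m G) u.
  rewrite qf_mulmx ?posdef_sym//; apply: (posdef_inv _ Ap).2.
  exact: posdef_mulmx_neq0.
rewrite /theta; have -> : b = Num.sqrt (b ^+ 2) by rewrite sqrtr_sqr gtr0_norm.
by rewrite ler_sqrt ?sqr_ge0// ler_pdivrMr//; exact: (qf_theta_le b c k).
Qed.

End QuadraticForms.

(** * One-variable derivatives and integrals over the unit interval *)

Section OneVariable.
Context {R : realType}.
Implicit Types (phi psi : R -> R) (c l k t s : R).

Lemma derive_le_right phi c k l t : is_derive t (1 : R) phi l -> 0 < k ->
  (forall s, 0 < s <= k -> phi (t + s) - phi t <= c * s) -> l <= c.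
Proof.
move=> [dphi <-] k0 hc; rewrite leNgt; apply/negP => cl.
(* With the excess of the slope over [c] as precision, some difference quotient at [0 < s <= k]
   exceeds [c]. *)
have e0 : 0 < 'D_1 phi t - c by rewrite subr_gt0.
have /cvgrPdist_lt /(_ _ e0) := dphi.
move=> [r /= r0 hr].
pose s := Num.min (r / 2) k.
have s0 : 0 < s by rewrite lt_min k0 divr_gt0.
have sr : s < r by rewrite gt_min; apply/orP; left; lra.
have sk : s <= k by rewrite ge_min lexx orbT.
have hq : 'D_1 phi t - s^-1 * (phi (t + s) - phi t) < 'D_1 phi t - c.
  apply: le_lt_trans (ler_norm _) _.
  have := hr s; rewrite /ball_ /= sub0r normrN gtr0_norm// => /(_ sr (lt0r_neq0 s0)).
  by rewrite /GRing.scale /= mulr1 (addrC s t).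
by have := hc s; rewrite s0 sk => /(_ isT); rewrite -ler_pdivrMr// mulrC; lra.
Qed.

Lemma lipschitz_continuous phi c :
  (forall s t, `|phi s - phi t| <= c * `|s - t|) -> continuous phi.
Proof.
move=> hc t; apply/cvgrPdist_le => /= e e0.
near=> s; apply: le_trans (hc _ _) _.
(* The sign of [c] is unknown, so a positive majorant replaces it. *)
have c1 : 0 < `|c| + 1 by rewrite ltr_wpDl.
apply: (@le_trans _ _ ((`|c| + 1) * `|t - s|)).
  by rewrite ler_wpM2r// (le_trans (ler_norm _))// lerDl.
rewrite -ler_pdivlMl// ltW//.
by near: s; apply: cvgr_dist_lt => //; rewrite mulr_gt0 ?invr_gt0.
Unshelve. all: by end_near. Qed.

(** Convertible with the entries of [Jmat], so that lemmas about it apply to them directly. *)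
Definition integral01 phi : R := Rintegral (@lebesgue_measure R) `[0, 1]%classic phi.

Lemma integrable01 phi : continuous phi ->
  (@lebesgue_measure R).-integrable `[0, 1]%classic (EFin \o phi).
Proof.
move=> cphi; apply: continuous_compact_integrable; first exact: segment_compact.
exact: continuous_subspaceT.
Qed.

Lemma le_integral01 phi psi : continuous phi -> continuous psi ->
  (forall t, 0 <= t <= 1 -> phi t <= psi t) -> integral01 phi <= integral01 psi.
Proof.
move=> cphi cpsi h; apply: le_Rintegral; [by []|exact: integrable01..|].
by move=> t /=; rewrite in_itv; exact: h.
Qed.

Lemma eq_integral01 phi psi :
  (forall t, 0 <= t <= 1 -> phi t = psi t) -> integral01 phi = integral01 psi.
Proof.
by move=> h; apply: eq_Rintegral => t; rewrite inE /= in_itv; exact: h.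
Qed.

Lemma integral01D phi psi : continuous phi -> continuous psi ->
  integral01 (fun t => phi t + psi t) = integral01 phi + integral01 psi.
Proof. by move=> cphi cpsi; apply: RintegralD => //; exact: integrable01. Qed.

Lemma integral01Z c phi : continuous phi ->
  integral01 (fun t => c * phi t) = c * integral01 phi.
Proof. by move=> cphi; apply: RintegralZl => //; exact: integrable01. Qed.

Lemma integral01_cst c : integral01 (fun=> c) = c.
Proof.
have mu01 : lebesgue_measure (`[0, 1]%classic : set R) = 1%:E.
  by rewrite (@lebesgue_measure_itv R `[0, 1]) /= lte_fin ltr01 oppr0 adde0.
rewrite /integral01 Rintegral_cst// -[RHS]mulr1.
by congr (_ * _); rewrite -[RHS]/(fine 1%:E); congr fine.
Qed.

Lemma integral01_FTC phi psi : continuous psi ->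
  (forall t, is_derive t (1 : R) phi (psi t)) -> integral01 psi = phi 1 - phi 0.
Proof.
move=> cpsi dphi; rewrite /integral01 /Rintegral.
have cphi t : {for t, continuous phi}.
  by apply: differentiable_continuous; apply/derivable1_diffP; case: (dphi t).
rewrite (@continuous_FTC2 _ psi phi)//.
- exact: continuous_subspaceT.
- split.
  + by move=> t _; case: (dphi t).
  + exact: cvg_at_right_filter (cphi 0).
  + exact: cvg_at_left_filter (cphi 1).
- by move=> t _; rewrite derive1E; case: (dphi t).
Qed.

Lemma integral01_id : integral01 id = 1 / 2.
Proof.
have d t : is_derive t (1 : R) (fun t => 2^-1 *: (t ^+ 2 : R)) (id t).
  by apply: is_derive_eq; rewrite /GRing.scale /=; field.
rewrite (integral01_FTC _ id _ d); last by move=> t; exact: cvg_id.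
by rewrite expr1n expr0n scaler0 subr0 /GRing.scale /= mulr1 div1r.
Qed.

Lemma continuous_sum n (F : 'I_n -> R -> R) : (forall i, continuous (F i)) ->
  continuous (fun t => \sum_i F i t).
Proof. by move=> cF; apply: continuous_big => // -[a b]; exact: add_continuous. Qed.

Lemma integral01_sum n (F : 'I_n -> R -> R) : (forall i, continuous (F i)) ->
  integral01 (fun t => \sum_i F i t) = \sum_i integral01 (F i).
Proof.
elim: n F => [|n IH] F cF.
  rewrite big_ord0 -[RHS](integral01_cst 0); congr (integral01 _).
  by apply/funext => t; rewrite big_ord0.
rewrite big_ord_recl -IH// -integral01D//; last exact: continuous_sum.
by congr (integral01 _); apply/funext => t; rewrite big_ord_recl.
Qed.

Lemma continuous_dist c : continuous (fun a : R => `|a - c|).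
Proof.
apply: (lipschitz_continuous _ 1) => p q.
by rewrite mul1r (le_trans (ler_dist_dist _ _))// opprB addrA subrK.
Qed.

(** The mean distance to an endpoint of the segment is the source of the [1/2] in [1 + M r / 2]. *)
Lemma integral01_dist c : c = 0 \/ c = 1 -> integral01 (fun a => `|a - c|) = 1 / 2.
Proof.
have cid : continuous (id : R -> R) by move=> a; exact: cvg_id.
case=> ->.
  rewrite -integral01_id; apply: eq_integral01 => a /andP[a0 _].
  by rewrite subr0 ger0_norm.
have : integral01 (fun a : R => `|a - 1| + id a) = 1.
  rewrite -[RHS](integral01_cst 1); apply: eq_integral01 => a /andP[_ a1].
  by rewrite ler0_norm ?subr_le0// opprB subrK.
by rewrite integral01D//; [rewrite integral01_id; lra|exact: continuous_dist].
Qed.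

End OneVariable.

(** * Restriction to lines and first-order remainders *)

Section Lines.
Context {R : realType}.

(** The two difference quotients are the same function of [h]. *)
Lemma is_derive_line {V W : normedModType R} (g : V -> W) x v (t : R) :
  derivable g (x + t *: v) v ->
  is_derive t (1 : R) (fun s : R => g (x + s *: v)) ('D_v g (x + t *: v)).
Proof.
have E : (fun h : R =>
      h^-1 *: (((fun s : R => g (x + s *: v)) \o shift t) (h *: 1) - g (x + t *: v)))
   = (fun h : R => h^-1 *: ((g \o shift (x + t *: v)) (h *: v) - g (x + t *: v))).
  apply/funext => h /=; congr (_ *: (g _ - _)).
  by rewrite [h *: 1]mulr1 scalerDl addrCA.
move=> dg; split; first by rewrite /derivable E.
by rewrite /derive E.
Qed.

Context {d : nat}.
Implicit Types u v w x h : 'cV[R]_d.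

Lemma is_derive_dotv w (g : R -> 'cV[R]_d) (dg : 'cV[R]_d) (t : R) :
  is_derive t (1 : R) g dg -> is_derive t (1 : R) (fun s => dotv w (g s)) (dotv w dg).
Proof.
move=> [dgt <-].
have -> : (fun s => dotv w (g s)) = \sum_i (fun s => w i 0 *: g s i 0).
  by apply/funext => s; rewrite dotvE fct_sumE.
have di i : derivable (fun s => g s i 0) t (1 : R) by exact: (derivable_mxP _ _ _).1.
have di' i : is_derive t (1 : R) (fun s => w i 0 *: g s i 0) (w i 0 *: 'D_1 (fun s => g s i 0) t).
  by apply: is_deriveZ; apply: derivableP.
apply: is_derive_eq.
rewrite dotvE derive_mx//; by apply: eq_bigr => i _; rewrite mxE.
Qed.

Lemma normr_dotv_le w : exists2 c : R, 0 < c & forall v, `|dotv w v| <= c * `|v|.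
Proof.
(* The norm on column vectors is the maximum norm, so the l1 norm of [w] is a valid constant; the
   [+ 1] makes it positive even for [w = 0]. *)
exists (\sum_i `|w i 0| + 1); first by rewrite ltr_wpDl// sumr_ge0.
move=> v; apply: (@le_trans _ _ ((\sum_i `|w i 0|) * `|v|)); last first.
  by rewrite ler_wpM2r// lerDl.
rewrite dotvE (le_trans (ler_norm_sum _ _ _))// mulr_suml ler_sum// => i _.
rewrite normrM ler_wpM2l//.
rewrite [leRHS]/Num.Def.normr/= mx_normrE.
exact: (le_bigmax _ (fun i : 'I_d * 'I_1 => `|v i.1 i.2|) (i, 0)).
Qed.

(** The remainder is uniform in the direction of [h], as [second_difference] requires: its
    increments involve an unspecified intermediate point. *)
Lemma differentiable_dotv (g : 'cV[R]_d -> 'cV[R]_d) x w (e : R) :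
  differentiable g x -> 0 < e ->
  exists2 r : R, 0 < r & forall h, `|h| < r ->
    `|dotv w (g (h + x) - g x - 'D_h g x)| <= e * `|h|.
Proof.
move=> dg e0; have [c c0 hc] := normr_dotv_le w.
have ec0 : 0 < e / c by rewrite divr_gt0.
have /eqaddoP /(_ _ ec0) := diff_locally dg.
move=> /nbhs_normP[r /= r0 hr]; exists r => // h hhr.
apply: le_trans (hc _) _.
rewrite -ler_pdivlMl// mulrA (mulrC c^-1).
have := hr h; rewrite /ball_ /= sub0r normrN => /(_ hhr).
by rewrite /GRing.add /= /GRing.opp /= deriveE// opprD addrA.
Qed.

End Lines.

(** * Symmetry and spectral bounds of the Hessian *)

Section Hessian.
Context {R : realType} {d : nat}.
Context (f : 'cV[R]_d -> R) (grad : 'cV[R]_d -> 'cV[R]_d) (hess : 'cV[R]_d -> 'M[R]_d).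
Context (gh : is_grad_hess f grad hess).
Implicit Types (x y z u v w s : 'cV[R]_d) (t e : R).

Lemma is_derive_f_line x v t :
  is_derive t (1 : R) (fun a : R => f (x + a *: v)) (dotv (grad (x + t *: v)) v).
Proof.
have [df _ <- _] := gh (x + t *: v).
by apply: is_derive_line; exact: diff_derivable.
Qed.

Lemma is_derive_grad_line w x v t :
  is_derive t (1 : R) (fun a : R => dotv w (grad (x + a *: v)))
                      (dotv w (hess (x + t *: v) *m v)).
Proof.
have [_ dg _ <-] := gh (x + t *: v).
by apply: is_derive_dotv; apply: is_derive_line; exact: diff_derivable.
Qed.

(** The mean value theorem along [u] leaves a difference of two gradients; expanding both at [x],
    the terms in [hess x *m u] cancel. *)
Lemma second_difference x u v e : 0 < e ->
  exists2 r : R, 0 < r & forall t, 0 < t < r ->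
    `|f (x + t *: v + t *: u) - f (x + t *: u) - (f (x + t *: v) - f x)
      - t ^+ 2 * dotv u (hess x *m v)| <= e * t ^+ 2.
Proof.
move=> e0.
(* [t * C] dominates the sum of the lengths of the two increments [t *: v + a *: u] and [a *: u];
   the [+ 1] ensures positivity. *)
pose C : R := `|u| + `|u| + `|v| + 1.
have nu := normr_ge0 u; have nv := normr_ge0 v.
have C0 : 0 < C by rewrite /C; lra.
have [_ dg _ Dg] := gh x.
have [r r0 hr] := differentiable_dotv grad x u (e / C) dg (divr_gt0 e0 C0).
exists (r / C); first exact: divr_gt0.
move=> t /andP[t0]; rewrite ltr_pdivlMr// => tr.
pose phi (a : R) := f (x + t *: v + a *: u) - f (x + a *: u).
have dphi a : is_derive a (1 : R) phi
    (dotv (grad (x + t *: v + a *: u)) u - dotv (grad (x + a *: u)) u).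
  by apply: is_deriveB; exact: is_derive_f_line.
have cphi : {within `[0, t], continuous phi}%classic.
  by apply: derivable_within_continuous => a _; case: (dphi a).
have [a] := MVT t0 (fun a _ => dphi a) cphi.
rewrite in_itv /= => /andP[a0 at_].
rewrite /phi !scale0r !addr0 subr0 => ->.
have h1 : `|a *: u| <= t * `|u| by rewrite normrZ gtr0_norm// ler_wpM2r// ltW.
have h2 : `|t *: v + a *: u| <= t * (`|v| + `|u|).
  by rewrite (le_trans (ler_normD _ _))// mulrDr lerD// normrZ gtr0_norm.
have uC : t * `|u| < r by rewrite /C in tr; nra.
have vC : t * (`|v| + `|u|) < r by rewrite /C in tr; nra.
have := hr _ (le_lt_trans h1 uC); have := hr _ (le_lt_trans h2 vC).
rewrite !Dg !mulmxDr -!scalemxAr (addrC _ x) (addrC _ x) addrA.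
rewrite !(dotvBr u) !dotvDr !dotvZr !(dotvC u (grad _)) => k1 k2.
set X := dotv (grad (x + t *: v + a *: u)) u in k1 *.
set Y := dotv (grad (x + a *: u)) u in k2 *.
set Z := dotv u (hess x *m v) in k1 *.
set W := dotv u (hess x *m u) in k1 k2.
set g := dotv (grad x) u in k1 k2.
have -> : (X - Y) * t - t ^+ 2 * Z
   = t * ((X - g - (t * Z + a * W)) - (Y - g - a * W)) by ring.
rewrite normrM gtr0_norm// expr2 mulrCA ler_pM2l//.
apply: le_trans (ler_normB _ _) _.
apply: le_trans (lerD k1 k2) _.
have eC : e * t = e / C * (t * C) by field; rewrite gt_eqF.
by rewrite eC -mulrDr ler_wpM2l ?divr_ge0 ?ltW// /C; lra.
Qed.

(* Both second differences in (u, v) and (v, u) are the same number, so the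
   bilinear form of the Hessian is symmetric. *)
Lemma hess_sym x : (hess x)^T = hess x.
Proof.
have S u v : dotv u (hess x *m v) = dotv v (hess x *m u).
  apply/eqP; rewrite -subr_eq0 -normr_le0; apply/ler_addgt0Pr => e e0; rewrite add0r.
  have e20 : 0 < e / 2 by rewrite divr_gt0.
  have [r1 r10 h1] := second_difference x u v (e / 2) e20.
  have [r2 r20 h2] := second_difference x v u (e / 2) e20.
  pose t := Num.min r1 r2 / 2.
  have m0 : 0 < Num.min r1 r2 by rewrite lt_min r10.
  have t0 : 0 < t by rewrite divr_gt0.
  have tm : t < Num.min r1 r2 by rewrite /t; lra.
  have tr1 : 0 < t < r1 by rewrite t0 (lt_le_trans tm)// ge_min lexx.
  have tr2 : 0 < t < r2 by rewrite t0 (lt_le_trans tm)// ge_min lexx orbT.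
  have := h1 t tr1; have := h2 t tr2.
  rewrite (addrAC x (t *: u)).
  set F := f (x + t *: v + t *: u); set F1 := f (x + t *: u); set F2 := f (x + t *: v).
  set c1 := dotv u _; set c2 := dotv v _ => k2 k1.
  have t20 : 0 < t ^+ 2 by rewrite exprn_gt0.
  rewrite -(ler_pM2l t20) -[t ^+ 2 in leLHS]gtr0_norm// -normrM.
  have -> : t ^+ 2 * (c1 - c2) = (F - F2 - (F1 - f x) - t ^+ 2 * c2)
      - (F - F1 - (F2 - f x) - t ^+ 2 * c1) by ring.
  by apply: le_trans (ler_normB _ _) _; apply: le_trans (lerD k2 k1) _; lra.
apply/matrixP => i j; rewrite mxE.
by have := S (delta_mx j 0) (delta_mx i 0); rewrite -!colE !dotv_delta !mxE.
Qed.

(** Strong convexity gives the first-order bound [above]; adding it for both orders of the points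
    makes the gradient strongly monotone, and its difference quotients along [v] inherit the
    constant. *)
Lemma strongly_convex_qf mu x v : 0 < mu -> strongly_convex mu f ->
  mu * dotv v v <= qf (hess x) v.
Proof.
move=> mu0 sc.
have above y z : f y + dotv (grad y) (z - y) + mu / 2 * dotv (z - y) (z - y) <= f z.
  set N := dotv (z - y) (z - y); have N0 : 0 <= N := dotv_ge0 _.
  apply/ler_addgt0Pr => e e0.
  (* For [0 < a <= k] the factor [1 - a] of the convexity inequality is at least [1 - k], which
     costs [mu / 2 * N * k <= e]. *)
  pose k := Num.min 1 (e / (mu / 2 * N + 1)).
  have mN : 0 <= mu / 2 * N by rewrite mulr_ge0// divr_ge0 ?ltW.
  have k0 : 0 < k by rewrite lt_min ltr01 divr_gt0//; lra.
  have k1 : k <= 1 by rewrite ge_min lexx.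
  have ke : mu / 2 * N * k <= e.
    have : k * (mu / 2 * N + 1) <= e.
      by rewrite -ler_pdivlMr; [rewrite /k ge_min lexx orbT|lra].
    by nra.
  have dl : is_derive (0 : R) (1 : R) (fun a : R => f (y + a *: (z - y))) (dotv (grad y) (z - y)).
    by have := is_derive_f_line y (z - y) 0; rewrite scale0r addr0.
  have := @derive_le_right R _ (f z - f y - mu / 2 * N * (1 - k)) k _ _ dl k0.
  rewrite scale0r addr0 => h.
  have {}h : dotv (grad y) (z - y) <= f z - f y - mu / 2 * N * (1 - k).
    apply: h => a /andP[a0 ak]; rewrite add0r.
    have a1 : 0 <= a <= 1 by rewrite ltW//= (le_trans ak).
    have := sc z y a a1; rewrite enorm_sqr -/N.
    have -> : a *: z + (1 - a) *: y = y + a *: (z - y).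
      by rewrite scalerBl scalerBr scale1r addrCA.
    move=> h.
    have : 0 <= mu / 2 * N * a * (k - a) by rewrite !mulr_ge0 ?subr_ge0// ltW.
    by nra.
  by nra.
have mono y z : mu * dotv (z - y) (z - y) <= dotv (grad z - grad y) (z - y).
  have := above y z; have := above z y.
  by rewrite -(opprB z y) dotvNl !dotvNr (dotvBl (z - y) (grad z)); lra.
have [->|v0] := eqVneq v 0; first by rewrite dotv0r mulr0 qfE mulmx0 dotv0r.
(* [derive_le_right] bounds slopes from above, so the gradient is paired with [- v] to obtain a
   lower bound. *)
have := is_derive_grad_line (- v) x v 0.
rewrite scale0r addr0 => dl.
rewrite qfE -lerN2 -dotvNl -mulNr.
apply: (derive_le_right _ _ _ _ _ dl ltr01) => a /andP[a0 _].
have := mono x (x + a *: v).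
rewrite add0r scale0r addr0 (addrC x) addrK !dotvZr dotvZl !dotvNl !(dotvC v).
by rewrite dotvBl mulrCA ler_pM2l//; lra.
Qed.

(** Cauchy-Schwarz bounds the difference quotients of [<v, grad>] along [v]. *)
Lemma lipschitz_grad_qf L x v : lipschitz_grad L grad ->
  qf (hess x) v <= L * dotv v v.
Proof.
move=> lip.
have := is_derive_grad_line v x v 0.
rewrite scale0r addr0 -qfE => dl.
apply: (derive_le_right _ _ _ _ _ dl ltr01) => a /andP[a0 _].
rewrite add0r scale0r addr0 -dotvBr.
apply: le_trans (dotv_le_enorm _ _) _.
have := lip (x + a *: v) x; rewrite (addrC x) addrK.
have -> : enorm (a *: v) = a * enorm v.
  by rewrite /enorm dotvZl dotvZr mulrA -expr2 sqrtrM ?sqr_ge0// sqrtr_sqr gtr0_norm.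
move=> h; apply: le_trans (ler_wpM2l (enorm_ge0 v) h) _.
rewrite -enorm_sqr; lra.
Qed.

End Hessian.

(** * The averaged Hessian along a step *)

Section AverageHessian.
Context {R : realType} {d : nat}.
Context (f : 'cV[R]_d -> R) (grad : 'cV[R]_d -> 'cV[R]_d) (hess : 'cV[R]_d -> 'M[R]_d).
Context (M : R) (gh : is_grad_hess f grad hess) (sc : strongly_self_concordant M hess).
Implicit Types (x y z u v w s : 'cV[R]_d) (a b t : R).

Lemma lnormZ (H : 'M[R]_d) a u : lnorm H (a *: u) = `|a| * lnorm H u.
Proof. by rewrite /lnorm qf_scale sqrtrM ?sqr_ge0// sqrtr_sqr. Qed.

(** The norm is always taken at the base point [x], so every pair of points on the line is
    controlled by the one length [lnorm (hess x) s]. *)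
Lemma self_concordant_line x s a b w u :
  qf (hess (x + a *: s)) u - qf (hess (x + b *: s)) u
    <= M * lnorm (hess x) s * `|a - b| * qf (hess w) u.
Proof.
have := sc (x + b *: s) (x + a *: s) x w u.
by rewrite qfB qfZ opprD addrACA subrr add0r -scalerBl lnormZ (mulrC `|_|) !mulrA.
Qed.

(** Continuity comes from self-concordance: with reference point [x], exchanging [a] and [b] gives a
    Lipschitz bound. *)
Lemma continuous_qf_line x s u : continuous (fun a : R => qf (hess (x + a *: s)) u).
Proof.
apply: (@lipschitz_continuous _ _ (M * lnorm (hess x) s * qf (hess x) u)) => a b.
rewrite ler_norml lerNl opprB (mulrAC _ (qf _ u)).
have h1 := self_concordant_line x s a b x u.
have h2 := self_concordant_line x s b a x u; rewrite distrC in h2.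
by rewrite h1 h2.
Qed.

Lemma continuous_dotv_line x s u v :
  continuous (fun a : R => dotv u (hess (x + a *: s) *m v)).
Proof.
(* Polarization, written with [u - (-1) *: v] for the sum so that [qf_sym_expand] matches both
   terms. *)
have E a : dotv u (hess (x + a *: s) *m v) =
   4^-1 * (qf (hess (x + a *: s)) (u - (-1) *: v) - qf (hess (x + a *: s)) (u - 1 *: v)).
  have Hs := hess_sym f grad hess gh (x + a *: s).
  by rewrite !qf_sym_expand// (dotv_sym _ v u)//; field.
under eq_fun do rewrite E.
move=> a; apply: cvgM; first exact: cvg_cst.
by apply: cvgB; exact: continuous_qf_line.
Qed.

Lemma dotv_Jmat x s u v :
  dotv u (Jmat hess x s *m v) = integral01 (fun a => dotv u (hess (x + a *: s) *m v)).
Proof.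
have c1 i j : continuous (fun a : R => hess (x + a *: s) i j).
  have := continuous_dotv_line x s (delta_mx i 0) (delta_mx j 0).
  by under eq_fun do rewrite -colE dotv_delta mxE.
have c2 i j k : continuous (fun a : R => k * hess (x + a *: s) i j).
  by move=> a; apply: cvgM; [exact: cvg_cst|exact: c1].
have E (A : 'M[R]_d) : dotv u (A *m v) = \sum_i \sum_j (u i 0 * v j 0) * A i j.
  rewrite dotvE; apply: eq_bigr => i _; rewrite mxE mulr_sumr.
  by apply: eq_bigr => j _; rewrite mulrCA mulrC.
under eq_fun do rewrite E.
rewrite E integral01_sum; last by move=> i; apply: continuous_sum => j; exact: c2.
apply: eq_bigr => i _; rewrite integral01_sum; last by move=> j; exact: c2.
by apply: eq_bigr => j _; rewrite mxE integral01Z.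
Qed.

Lemma Jmat_sym x s : (Jmat hess x s)^T = Jmat hess x s.
Proof.
apply/matrixP => i j; rewrite !mxE; congr Rintegral.
by apply/funext => a; rewrite -[in LHS](hess_sym f grad hess gh) mxE.
Qed.

Lemma qf_Jmat x s u :
  qf (Jmat hess x s) u = integral01 (fun a => qf (hess (x + a *: s)) u).
Proof. by rewrite qfE dotv_Jmat; under eq_fun do rewrite -qfE. Qed.

(** Coordinate by coordinate, this is the fundamental theorem of calculus for the gradient along the
    segment. *)
Lemma Jmat_secant x s : Jmat hess x s *m s = grad (x + s) - grad x.
Proof.
apply/matrixP => i j; rewrite ord1 -!(dotv_delta i) dotv_Jmat.
rewrite (integral01_FTC _ _ (continuous_dotv_line _ _ _ _)
  (is_derive_grad_line f grad hess gh (delta_mx i 0) x s)).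
by rewrite scale1r scale0r addr0 dotvBr.
Qed.

(* The self-concordance bound holds for every reference point w, so it may be
   averaged over w as well, which puts J on its right-hand side. *)
Lemma Jmat_equiv x s b u : b = 0 \/ b = 1 ->
  let k := 1 + M * lnorm (hess x) s / 2 in
  qf (Jmat hess x s) u <= k * qf (hess (x + b *: s)) u /\
  qf (hess (x + b *: s)) u <= k * qf (Jmat hess x s) u.
Proof.
move=> b01 k; set c := M * lnorm (hess x) s in k *.
have cq := continuous_qf_line x s u.
have cb := continuous_dist b.
have cst_c (q : R) : continuous (fun _ : R => q) by exact: cst_continuous.
have cZ q : continuous (fun a : R => q * `|a - b|).
  by move=> a; apply: cvgM; [exact: cvg_cst|exact: cb].
have cDZ p q : continuous (fun a : R => p + q * `|a - b|).
  by move=> a; apply: cvgD; [exact: cvg_cst|exact: cZ].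
have ID p q : integral01 (fun a => p + q * `|a - b|) = p + q / 2.
  by rewrite integral01D// integral01_cst integral01Z// integral01_dist//; lra.
set h := qf (hess (x + b *: s)) u.
have upper w : qf (Jmat hess x s) u <= h + c * qf (hess w) u / 2.
  rewrite qf_Jmat -ID; apply: le_integral01 => // a _.
  have := self_concordant_line x s a b w u; rewrite -/c -/h; lra.
have lower w : h - c * qf (hess w) u / 2 <= qf (Jmat hess x s) u.
  rewrite -mulNr -ID qf_Jmat; apply: le_integral01 => // a _.
  have := self_concordant_line x s b a w u; rewrite -/c -/h distrC; lra.
split; first by have := upper (x + b *: s); rewrite -/h /k; lra.
have I1 : integral01 (fun a => h - c / 2 * qf (hess (x + a *: s)) u)
    = h - c / 2 * qf (Jmat hess x s) u.
  rewrite qf_Jmat; under eq_fun do rewrite -mulNr.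
  rewrite integral01D// ?integral01_cst ?integral01Z// ?mulNr//.
  by move=> a; apply: cvgM; [exact: cvg_cst|exact: cq].
have : h - c / 2 * qf (Jmat hess x s) u <= qf (Jmat hess x s) u.
  rewrite -I1 -[leRHS]integral01_cst; apply: le_integral01 => //.
    by move=> a; apply: cvgB; [exact: cvg_cst|apply: cvgM; [exact: cvg_cst|exact: cq]].
  by move=> a _; have := lower (x + a *: s); lra.
rewrite /k; lra.
Qed.

End AverageHessian.

(** * One iteration of the method *)

Section Step.
Context {R : realType} {d : nat}.
Implicit Types (A B G H J : 'M[R]_d) (u s g e : 'cV[R]_d) (a b c k eta : R).

Lemma sharpened_update_bounds k eta H J H' G s e :
  posdef H -> posdef J -> posdef H' -> posdef G -> s != 0 -> e != 0 ->
  1 <= k -> 1 <= eta ->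
  (forall u, qf H u <= qf G u) -> (forall u, qf G u <= eta * qf H u) ->
  (forall u, qf J u <= k * qf H u) -> (forall u, qf H u <= k * qf J u) ->
  (forall u, qf J u <= k * qf H' u) -> (forall u, qf H' u <= k * qf J u) ->
  let G' := BFGS H' (k ^+ 2 *: BFGS J G s) e in
  [/\ posdef G', forall u, qf H' u <= qf G' u
    & forall u, qf G' u <= k ^+ 4 * eta * qf H' u].
Proof.
move=> Hp Jp H'p Gp s0 e0 k1 eta1 HG GH JH HJ JH' H'J G'.
have k0 : 0 < k by lra.
have eta0 : 0 < eta by lra.
have JG u : qf J u <= k * qf G u.
  by apply: le_trans (JH u) _; rewrite ler_pM2l.
have GJ u : qf G u <= k * eta * qf J u.
  by apply: le_trans (GH u) _; rewrite (mulrC k) -mulrA ler_pM2l.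
have Bp := posdef_BFGS k _ _ _ Jp Gp s0 k1 JG.
have JB := BFGS_ge k _ _ _ Jp Gp s0 k1 JG.
have keta1 : 1 <= k * eta by nra.
have BJ := BFGS_le (k * eta) _ _ _ Jp Gp s0 keta1 GJ.
have Ap : posdef (k ^+ 2 *: BFGS J G s) by apply: posdefZ => //; rewrite exprn_gt0.
have H'A u : qf H' u <= 1 * qf (k ^+ 2 *: BFGS J G s) u.
  rewrite qfZ mul1r expr2 -mulrA (le_trans (H'J u))// ler_pM2l//; exact: JB.
have AH' u : qf (k ^+ 2 *: BFGS J G s) u <= k ^+ 4 * eta * qf H' u.
  rewrite qfZ; apply: (@le_trans _ _ (k ^+ 2 * (k * eta * (k * qf H' u)))).
    rewrite ler_pM2l ?exprn_gt0// (le_trans (BJ u))// ler_pM2l ?mulr_gt0//; exact: JH'.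
  by rewrite le_eqVlt; apply/orP; left; apply/eqP; ring.
have k41 : 1 <= k ^+ 4 * eta by rewrite mulr_ege1// exprn_ege1.
split.
- exact: (posdef_BFGS 1).
- by move=> u; rewrite -[leRHS]mul1r; exact: BFGS_ge.
- exact: BFGS_le.
Qed.

(** Since [(G - J) s = - g'] and [G s = - g], the last hypothesis compares [g'] with [g] in the form
    of [J^-1]. Moving to [H'^-1] on the left and [H^-1] on the right costs [k] each, so [k] in total
    after the square root. *)
Lemma newton_dec_step k b H J H' G s g g' : posdef H -> posdef J -> posdef H' -> posdef G ->
  0 < k -> 0 < b -> G *m s = - g -> g' = g + J *m s ->
  (forall u, qf J u <= k * qf H' u) -> (forall u, qf H u <= k * qf J u) ->
  qf ((G - J) *m invmx J *m (G - J)) s <= b ^+ 2 * qf (G *m invmx J *m G) s ->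
  newton_dec g' H' <= k * b * newton_dec g H.
Proof.
move=> Hp Jp H'p Gp k0 b0 Gs gE JH' HJ.
have GJs : (G - J)^T = G - J by rewrite linearB /= !posdef_sym.
rewrite (qf_mulmx _ _ _ GJs) (qf_mulmx _ _ _ (posdef_sym Gp)).
have -> : (G - J) *m s = - g' by rewrite mulmxBl Gs gE opprD.
rewrite Gs !qfNr => h.
rewrite /newton_dec.
have -> : k * b = Num.sqrt ((k * b) ^+ 2) by rewrite sqrtr_sqr gtr0_norm ?mulr_gt0.
rewrite -sqrtrM ?sqr_ge0//; apply: ler_wsqrtr.
apply: le_trans (qf_inv_le _ _ _ k0 Jp H'p JH' _) _.
have h2 := qf_inv_le _ _ _ k0 Hp Jp HJ g.
apply: (@le_trans _ _ (k * (b ^+ 2 * (k * qf (invmx H) g)))); last first.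
  by rewrite le_eqVlt; apply/orP; left; apply/eqP; ring.
by rewrite ler_pM2l// (le_trans h)// ler_pM2l// exprn_gt0.
Qed.

(** [qf G s] equals [qf (invmx G) g], and inversion reverses [H <= G]. *)
Lemma lnorm_step_le H G s g : posdef H -> posdef G -> G *m s = - g ->
  (forall u, qf H u <= qf G u) -> lnorm H s <= newton_dec g H.
Proof.
move=> Hp Gp Gs HG; apply: ler_wsqrtr; apply: le_trans (HG s) _.
have -> : qf G s = qf (invmx G) g by rewrite -(qfNr _ g) -Gs qf_inv// posdef_mulKmx.
rewrite -[leRHS]mul1r; by apply: qf_inv_le => // u; rewrite mul1r.
Qed.

End Step.

(** * Numerical constants and growth of the error factor *)

Section Constants.
Context {R : realType}.

Lemma ln32_gt0 : 0 < ln (3 / 2 : R).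
Proof. by rewrite ln_gt0//; lra. Qed.

Lemma ln32_le : ln (3 / 2 : R) <= 1 / 2.
Proof. by have := @le_ln1Dx R (1 / 2); rewrite (_ : 1 + 1 / 2 = 3 / 2); [apply; lra|field]. Qed.

(* The telescoping bound [a <= l/4 (p - p')], with p, p' consecutive powers of
   the rate [1 - q/2], makes the four factors [1 + a] of one iteration fit
   into the increment of [expR (l (1 - p))], which never exceeds 3/2. *)
Lemma growth_step (q p a : R) : let l := ln (3 / 2) in
  0 <= a -> a <= l / 8 * q * p ->
  (1 + a) ^+ 4 * expR (l * (1 - p)) <= expR (l * (1 - (1 - q / 2) * p)).
Proof.
move=> l a0 al.
have -> : l * (1 - (1 - q / 2) * p) = 4 * (l / 8 * q * p) + l * (1 - p) by field.
rewrite expRD ler_pM2r ?expR_gt0//.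
rewrite expRM_natl lerXn2r ?nnegrE ?expR_ge0//; first lra.
by apply: le_trans (expR_ge1Dx a) _; rewrite ler_expR.
Qed.

End Constants.

(** * The induction on the iterations *)

Theorem theorem3 (R : realType) (d : nat) (f : 'cV[R]_d -> R)
    (grad : 'cV[R]_d -> 'cV[R]_d) (hess : 'cV[R]_d -> 'M[R]_d) (mu L M : R)
    (x : nat -> 'cV[R]_d) (G : nat -> 'M[R]_d) (ub : nat -> 'I_d) :
  0 < mu -> mu <= L -> 0 < M ->
  is_grad_hess f grad hess ->
  strongly_convex mu f -> lipschitz_grad L grad ->
  strongly_self_concordant M hess ->
  G 0%N = L%:M ->
  (forall t, x t.+1 = x t - invmx (G t) *m grad (x t)) ->
  (forall t,
     let s := x t.+1 - x t in
     let Gbar := BFGS (Jmat hess (x t) s) (G t) s in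
     let r := lnorm (hess (x t)) s in
     let Ghat := ((1 + M * r / 2) ^+ 2) *: Gbar in
     is_ubar (hess (x t.+1)) Ghat (ub t) /\
     G t.+1 = BFGS (hess (x t.+1)) Ghat (ebasis R (ub t))) ->
  (forall t, grad (x t) != 0) ->
  newton_dec (grad (x 0%N)) (hess (x 0%N)) <= (ln (3 / 2) / 4) * mu / (M * L) ->
  forall t,
    theta (Jmat hess (x t) (x t.+1 - x t)) (G t) (x t.+1 - x t) <= 1 - 2 * mu / (3 * L)
    /\ newton_dec (grad (x t)) (hess (x t))
       <= (1 - mu / (2 * L)) ^+ t * newton_dec (grad (x 0%N)) (hess (x 0%N)).
Proof.
move=> mu0 muL M0 gh scv lip ssc G0 xS GS grad0 lam0_le.
have L0 : 0 < L := lt_le_trans mu0 muL.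
pose q := mu / L.
have q0 : 0 < q by rewrite divr_gt0.
have q1 : q <= 1 by rewrite ler_pdivrMr// mul1r.
have -> : 1 - 2 * mu / (3 * L) = 1 - 2 / 3 * q by rewrite /q; field; rewrite gt_eqF.
have -> : 1 - mu / (2 * L) = 1 - q / 2 by rewrite /q; field; rewrite gt_eqF.
set rho := 1 - q / 2; set lam := fun t => newton_dec (grad (x t)) (hess (x t)).
rewrite -[newton_dec (grad (x 0%N)) _]/(lam 0%N).
set l : R := ln (3 / 2) in lam0_le.
have l0 : 0 < l := ln32_gt0.
have l1 : l <= 1 / 2 := ln32_le.
have Mlam0 : M * lam 0%N <= l / 4 * q.
  have -> : l / 4 * q = M * (l / 4 * mu / (M * L)) by rewrite /q; field; rewrite !gt_eqF.
  by rewrite ler_pM2l.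
have rho0 : 0 <= rho by rewrite /rho; lra.
have rho1 : rho <= 1 by rewrite /rho; lra.
have Hp y : posdef (hess y).
  split; first exact: (hess_sym f grad).
  move=> u u0; apply: lt_le_trans (strongly_convex_qf f grad hess gh _ y u mu0 scv).
  by rewrite mulr_gt0// dotv_gt0.
(* An explicit majorant of the condition factor: it starts at [1 / q = L / mu], as [G 0 = L I]
   requires, and never exceeds [3 / 2 / q] because [expR l = 3 / 2]. *)
pose eta t := expR (l * (1 - rho ^+ t)) / q.
(* The matrix bounds and the decay of [lam] go in one invariant: the decay limits the growth of
   [eta], and the matrix bounds yield the next decay. *)
pose P t := [/\ posdef (G t), forall u, qf (hess (x t)) u <= qf (G t) u,
  forall u, qf (G t) u <= eta t * qf (hess (x t)) u & lam t <= rho ^+ t * lam 0%N].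
suff step t : P t ->
    theta (Jmat hess (x t) (x t.+1 - x t)) (G t) (x t.+1 - x t) <= 1 - 2 / 3 * q /\ P t.+1.
  have P0 : P 0%N.
    have G0E u : qf (G 0%N) u = L * dotv u u by rewrite G0 qfE mul_scalar_mx dotvZr.
    split.
    - split; first by rewrite G0 tr_scalar_mx.
      by move=> u u0; rewrite G0E mulr_gt0// dotv_gt0.
    - by move=> u; rewrite G0E; exact: (lipschitz_grad_qf f grad hess gh).
    - move=> u; rewrite G0E /eta expr0 subrr mulr0 expR0 div1r /q invf_div -mulrA.
      rewrite ler_pM2l// ler_pdivlMl//; exact: (strongly_convex_qf f grad hess gh).
    - by rewrite expr0 mul1r.
  have Pt : forall t, P t by elim=> [//|t /step[]].
  by move=> t; split; [case: (step _ (Pt t))|case: (Pt t)].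
move=> [Gp HG GH lamt].
set s := x t.+1 - x t.
have sE : s = - (invmx (G t) *m grad (x t)) by rewrite /s xS addrAC subrr add0r.
have Gs : G t *m s = - grad (x t) by rewrite sE mulmxN posdef_mulKVmx.
have s0 : s != 0.
  by apply: contra (grad0 t) => /eqP h; rewrite -oppr_eq0 -Gs h mulmx0.
have xsE : x t.+1 = x t + s by rewrite /s addrC subrK.
have gE : grad (x t.+1) = grad (x t) + Jmat hess (x t) s *m s.
  by rewrite (Jmat_secant f grad hess M gh ssc) -xsE addrC subrK.
set r := lnorm (hess (x t)) s.
have r_ge0 : 0 <= r by exact: sqrtr_ge0.
have r_le : r <= lam t by exact: (lnorm_step_le _ (G t)).
pose a := M * r / 2.
have a0 : 0 <= a by rewrite /a; apply: divr_ge0 => //; rewrite mulr_ge0// ltW.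
have al : a <= l / 8 * q * rho ^+ t.
  have : M * r <= M * (rho ^+ t * lam 0%N) by rewrite ler_pM2l// (le_trans r_le).
  have := ler_wpM2l (exprn_ge0 t rho0) Mlam0; rewrite /a; lra.
have rt1 : rho ^+ t <= 1 by rewrite exprn_ile1.
have rt0 : 0 <= rho ^+ t by rewrite exprn_ge0.
(* This uses [l <= 1 / 2]; it makes [a] small against the margin [2 / 3 * q - q / 2] left between
   the [theta] bound and [rho]. *)
have aq : a <= q / 16.
  apply: le_trans al _.
  have : l / 8 * q * rho ^+ t <= l / 8 * q * 1.
    by rewrite ler_wpM2l//; apply: mulr_ge0; lra.
  nra.
pose k := 1 + a.
have k1 : 1 <= k by rewrite /k; lra.
have [JH0 HJ0] : (forall u, qf (Jmat hess (x t) s) u <= k * qf (hess (x t)) u) /\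
    (forall u, qf (hess (x t)) u <= k * qf (Jmat hess (x t) s) u).
  (* The endpoint [b = 0] is [x t]; below, [b = 1] is [x t.+1]. *)
  split=> u; have := Jmat_equiv f grad hess M gh ssc (x t) s 0 u (or_introl erefl);
  by rewrite scale0r addr0 => -[].
have [JH1 HJ1] : (forall u, qf (Jmat hess (x t) s) u <= k * qf (hess (x t.+1)) u) /\
    (forall u, qf (hess (x t.+1)) u <= k * qf (Jmat hess (x t) s) u).
  split=> u; have := Jmat_equiv f grad hess M gh ssc (x t) s 1 u (or_intror erefl);
  by rewrite scale1r -xsE => -[].
have k0 : 0 < k by lra.
have Jp : posdef (Jmat hess (x t) s).
  apply: (posdef_dominates k (hess (x t))) => //.
  exact: (Jmat_sym f grad hess gh).
have growth : k ^+ 4 * eta t <= eta t.+1.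
  rewrite /eta mulrA ler_pM2r ?invr_gt0// (exprS rho).
  exact: (growth_step q (rho ^+ t) a).
have eta1 : 1 <= eta t.
  rewrite /eta ler_pdivlMr// mul1r (le_trans q1)// -[leLHS]expR0 ler_expR.
  by rewrite mulr_ge0 ?subr_ge0// ltW.
(* The extra factor [k] paid for comparing with [J] fits under [k ^+ 4], hence under [eta t.+1]. *)
have eta_le : k * eta t <= 3 / 2 / q.
  apply: (@le_trans _ _ (eta t.+1)); last first.
    rewrite /eta ler_pM2r ?invr_gt0//.
    have -> : 3 / 2 = expR l :> R by rewrite lnK// posrE; lra.
    by rewrite ler_expR -[leRHS]mulr1 ler_pM2l// gerBl exprn_ge0//.
  apply: le_trans growth; rewrite ler_pM2r ?(lt_le_trans ltr01)//.
  by rewrite -[leLHS]expr1 ler_weXn2l.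
have JG u : qf (Jmat hess (x t) s) u <= k * qf (G t) u.
  by apply: le_trans (JH0 u) _; rewrite ler_pM2l.
have GJ u : qf (G t) u <= 3 / 2 / q * qf (Jmat hess (x t) s) u.
  apply: le_trans (GH u) _; apply: (@le_trans _ _ (k * eta t * qf (Jmat hess (x t) s) u)).
    by rewrite (mulrC k) -(mulrA (eta t)) ler_pM2l// (lt_le_trans ltr01).
  by rewrite ler_wpM2r// posdef_ge0.
have b0 : 0 < 1 - 2 / 3 * q by lra.
have kb : k - 1 <= 1 - 2 / 3 * q by rewrite /k; lra.
(* The upper bound on [G] decides the [theta] estimate, with equality here; the lower one
   contributes only [k - 1 <= q / 16]. *)
have qb : 1 - (3 / 2 / q)^-1 <= 1 - 2 / 3 * q.
  by rewrite (_ : (3 / 2 / q)^-1 = 2 / 3 * q)//; field; rewrite gt_eqF.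
have q32 : 0 < 3 / 2 / q by rewrite divr_gt0//; lra.
split; first exact: (theta_le _ k (3 / 2 / q)).
have [_ GE] := GS t.
have e0 : ebasis R (ub t) != 0.
  apply/negP => /eqP/matrixP/(_ (ub t) 0); rewrite !mxE !eqxx /= => /eqP.
  by rewrite oner_eq0.
have [G'p HG' GH'] := sharpened_update_bounds k (eta t) _ _ _ _ _ _
  (Hp (x t)) Jp (Hp (x t.+1)) Gp s0 e0 k1 eta1 HG GH JH0 HJ0 JH1 HJ1.
rewrite /P GE; split=> //.
- move=> u; apply: le_trans (GH' u) _.
  by rewrite ler_wpM2r// posdef_ge0.
- have := newton_dec_step k _ _ _ _ _ _ _ _ (Hp (x t)) Jp (Hp (x t.+1)) Gp k0 b0 Gs gE JH1 HJ0
    (qf_theta_le _ k (3 / 2 / q) _ _ s Jp Gp k0 q32 b0 kb qb JG GJ).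
  move=> h; apply: le_trans h _; rewrite (exprS rho) -(mulrA rho).
  have lam_ge0 : 0 <= lam t by exact: sqrtr_ge0.
  apply: (@le_trans _ _ (rho * lam t)); last by rewrite ler_wpM2l.
  (* [(1 + q / 16) * (1 - 2 / 3 * q) <= 1 - q / 2], since [1 / 16 <= 2 / 3 - 1 / 2]. *)
  by rewrite -/(lam t) ler_wpM2r// /k /rho; nra.
Qed.
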